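(* Let $\mathbb{F}$ be a field of characteristic different from two. If $(\mathcal{P}=\mathcal{P}_0\oplus\mathcal{P}_1,\circ,\{\cdot,\cdot\})$ is a transposed Poisson superalgebra over $\mathbb{F}$, then its Kantor double $\mathfrak{J}(\mathcal{P})$ is a Jordan superalgebra.
   Context: A transposed Poisson superalgebra is a $\mathbb{Z}_2$-graded vector space $\mathcal{P}=\mathcal{P}_0\oplus\mathcal{P}_1$ with two grading-compatible multiplications: an associative supercommutative multiplication $\circ$ (not necessarily unital) and a Lie superalgebra bracket $\{\cdot,\cdot\}$ (that is, $\{x,y\}=-(-1)^{|x||y|}\{y,x\}$ and $(-1)^{|x||z|}\{\{x,y\},z\}+(-1)^{|y||x|}\{\{y,z\},x\}+(-1)^{|z||y|}\{\{z,x\},y\}=0$) such that $2x\circ\{y,z\}=\{x\circ y,z\}+(-1)^{|x||y|}\{y,x\circ z\}$ for all homogeneous $x,y,z$, where $|x|$ is the parity of $x$. (The case $\mathcal{P}_1=0$ is that of transposed Poisson algebras.) Kantor double: let $\mathcal{P}^s=\{x^s:x\in\mathcal{P}\}$ be a copy of the vector space $\mathcal{P}$ with opposite parity, so $x^s$ has parity $|x|+1$. $\mathfrak{J}(\mathcal{P})=\mathcal{P}\oplus\mathcal{P}^s$ has even part $\mathcal{P}_0\oplus\mathcal{P}_1^s$, odd part $\mathcal{P}_1\oplus\mathcal{P}_0^s$, and bilinear multiplication given for homogeneous $x,y\in\mathcal{P}$ by $x*y=x\circ y$, $x^s*y=(x\circ y)^s$, $x*y^s=(-1)^{|x|}(x\circ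 y)^s$, $x^s*y^s=(-1)^{|x|}\{x,y\}$. A Jordan superalgebra is a superalgebra $\mathcal{J}=\mathcal{J}_0\oplus\mathcal{J}_1$ with product $\cdot$ such that, for all homogeneous $x,y,z$, $x\cdot y=(-1)^{|x||y|}y\cdot x$ and $(-1)^{|x||z|}[L_{x\cdot y},L_z]+(-1)^{|y||x|}[L_{y\cdot z},L_x]+(-1)^{|z||y|}[L_{z\cdot x},L_y]=0$, where $L_x$ is left multiplication by $x$ and $[L_x,L_y]=L_xL_y-(-1)^{|x||y|}L_yL_x$. *)

(* Defs.v *)
From HB Require Import structures.
From mathcomp Require Import all_boot all_order all_algebra.

Set Implicit Arguments.
Unset Strict Implicit.
Unset Printing Implicit Defensive.

Import GRing.Theory.
Local Open Scope ring_scope.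

(* A Z_2-graded space V = V0 (+) V1, of arbitrary dimension, is the external   *)
(* direct sum V0 * V1.  Parities are booleans (true = odd), added with (+) and *)
(* multiplied with &&, so (-1) ^+ (i && j) is the sign (-1)^{|x||y|}.  The     *)
(* vector 0 is homogeneous of both parities.                                   *)
Definition homog (F : fieldType) (V0 V1 : lmodType F) (i : bool)
    (x : V0 * V1) : Prop :=
  if i then x.1 = 0 else x.2 = 0.

Section Superalgebras.
Variables (F : fieldType) (V0 V1 : lmodType F).
Local Notation V := (V0 * V1)%type.
Implicit Types mul br : V -> V -> V.

Record superalgebra mul : Prop := {
  superalgebra_bilinear : bilinear_for *:%R *:%R mul;
  superalgebra_graded : forall (i j : bool) (x y : V),
    homog i x -> homog j y -> homog (i (+) j) (mul x y)
}.

Definition supercommutative mul : Prop :=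
  forall (i j : bool) (x y : V), homog i x -> homog j y ->
    mul x y = (-1) ^+ (i && j) *: mul y x.

Definition superanticommutative br : Prop :=
  forall (i j : bool) (x y : V), homog i x -> homog j y ->
    br x y = - ((-1) ^+ (i && j) *: br y x).

Definition super_jacobi br : Prop :=
  forall (i j k : bool) (x y z : V), homog i x -> homog j y -> homog k z ->
    (-1) ^+ (i && k) *: br (br x y) z
    + (-1) ^+ (j && i) *: br (br y z) x
    + (-1) ^+ (k && j) *: br (br z x) y = 0.

(* In characteristic 3 no condition {x, {x, x}} = 0 on odd x is imposed. *)
Record Lie_superalgebra br : Prop := {
  Lie_superalgebra_superalgebra : superalgebra br;
  Lie_superalgebra_anticomm : superanticommutative br;
  Lie_superalgebra_jacobi : super_jacobi br
}.

Definition transposed_Leibniz mul br : Prop :=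
  forall (i j k : bool) (x y z : V), homog i x -> homog j y -> homog k z ->
    2%:R *: mul x (br y z)
    = br (mul x y) z + (-1) ^+ (i && j) *: br y (mul x z).

Record transposed_Poisson_superalgebra mul br : Prop := {
  tPoisson_superalgebra : superalgebra mul;
  tPoisson_assoc : associative mul;
  tPoisson_supercomm : supercommutative mul;
  tPoisson_Lie : Lie_superalgebra br;
  tPoisson_Leibniz : transposed_Leibniz mul br
}.

(* [f, g] for operators f, g of parities i, j. *)
Definition super_commutator (i j : bool) (f g : V -> V) : V -> V :=
  (f \o g) \- ((-1) ^+ (i && j) \*: (g \o f)).

(* The left multiplication L_x is the partial application mul x. *)
Definition super_Jordan_identity mul : Prop :=
  forall (i j k : bool) (x y z : V), homog i x -> homog j y -> homog k z ->
    ((-1) ^+ (i && k) \*: super_commutator (i (+) j) k (mul (mul x y)) (mul z))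
    \+ ((-1) ^+ (j && i) \*: super_commutator (j (+) k) i (mul (mul y z)) (mul x))
    \+ ((-1) ^+ (k && j) \*: super_commutator (k (+) i) j (mul (mul z x)) (mul y))
    =1 \0.

Record Jordan_superalgebra mul : Prop := {
  Jordan_superalgebra_superalgebra : superalgebra mul;
  Jordan_superalgebra_supercomm : supercommutative mul;
  Jordan_superalgebra_identity : super_Jordan_identity mul
}.

End Superalgebras.

Section KantorDouble.
Variables (F : fieldType) (P0 P1 : lmodType F).
Local Notation P := (P0 * P1)%type.

(* P (+) P^s with its grading: even part P0 (+) P1^s, odd part P1 (+) P0^s. *)
Local Notation J := ((P0 * P1) * (P1 * P0))%type.

(* x |-> x and x |-> x^s *)
Definition kantor_in (x : P) : J := ((x.1, 0), (x.2, 0)).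
Definition kantor_s (x : P) : J := ((0, x.2), (0, x.1)).

(* The components a, b of u = a + b^s. *)
Definition kantor_fst (u : J) : P := (u.1.1, u.2.1).
Definition kantor_snd (u : J) : P := (u.2.2, u.1.2).

(* The linear extension of x |-> (-1)^{|x|} x. *)
Definition parity_sign (x : P) : P := (x.1, - x.2).

(* The bilinear extension of the products of homogeneous elements (see         *)
(* kantor_mul_in_in, kantor_mul_s_in, kantor_mul_in_s, kantor_mul_s_s):        *)
(* (a + b^s) * (c + d^s) =                                                     *)
(*   a o c + {(-1)^{|b|} b, d} + (b o c)^s + (((-1)^{|a|} a) o d)^s.           *)
Definition kantor_mul (mul br : P -> P -> P) (u v : J) : J :=
  let a := kantor_fst u in let b := kantor_snd u in
  let c := kantor_fst v in let d := kantor_snd v in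
  kantor_in (mul a c + br (parity_sign b) d)
  + kantor_s (mul b c + mul (parity_sign a) d).

Lemma kantor_decomp (u : J) :
  u = kantor_in (kantor_fst u) + kantor_s (kantor_snd u).
Proof.
by case: u => [[a b] [c d]]; congr (_, _); congr (_, _); rewrite /= ?add0r ?addr0.
Qed.

Lemma homog_kantor_in (i : bool) (x : P) : homog i x -> homog i (kantor_in x).
Proof. by case: i; rewrite /homog /= => ->. Qed.

Lemma homog_kantor_s (i : bool) (x : P) : homog i x -> homog (~~ i) (kantor_s x).
Proof. by case: i; rewrite /homog /= => ->. Qed.

Lemma parity_sign_homog (i : bool) (x : P) :
  homog i x -> parity_sign x = (-1) ^+ i *: x.
Proof.
case: x i => [x0 x1] [] /= ->; rewrite /parity_sign /= ?expr1 ?expr0.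
  by rewrite scaleN1r; congr (_, _); rewrite oppr0.
by rewrite scale1r oppr0.
Qed.

Lemma kantor_fst_in (x : P) : kantor_fst (kantor_in x) = x. Proof. by case: x. Qed.
Lemma kantor_snd_in (x : P) : kantor_snd (kantor_in x) = 0. Proof. by []. Qed.
Lemma kantor_fst_s (x : P) : kantor_fst (kantor_s x) = 0. Proof. by []. Qed.
Lemma kantor_snd_s (x : P) : kantor_snd (kantor_s x) = x. Proof. by case: x. Qed.
Definition kantor_compE :=
  (kantor_fst_in, kantor_snd_in, kantor_fst_s, kantor_snd_s).

Lemma kantor_in0 : kantor_in 0 = 0. Proof. by []. Qed.
Lemma kantor_s0 : kantor_s 0 = 0. Proof. by []. Qed.
Lemma parity_sign0 : parity_sign 0 = 0.
Proof. by congr (_, _); rewrite oppr0. Qed.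

Section Products.
Variables (mul br : P -> P -> P).
Hypotheses (mulP : superalgebra mul) (brP : superalgebra br).

Lemma superalgebra_mul0 (m : P -> P -> P) : superalgebra m ->
  [/\ forall x, m x 0 = 0, forall x, m 0 x = 0
    & forall (a : F) x y, m (a *: x) y = a *: m x y].
Proof.
case=> [[hl hr] _].
have m0l x : m 0 x = 0.
  have := hl x 1 0 0; rewrite /= !scale1r addr0 => h.
  by apply: (@addrI _ (m 0 x)); rewrite -h addr0.
split=> //.
- move=> x; have := hr x 1 0 0; rewrite /= !scale1r addr0 => h.
  by apply: (@addrI _ (m x 0)); rewrite -h addr0.
- by move=> a x y; have := hl y a x 0; rewrite /= m0l !addr0.
Qed.

Lemma kantor_mul_in_in (x y : P) :
  kantor_mul mul br (kantor_in x) (kantor_in y) = kantor_in (mul x y).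
Proof.
have [m0 n0 _] := superalgebra_mul0 mulP.
have [b0 _ _] := superalgebra_mul0 brP.
rewrite /kantor_mul !kantor_compE ?parity_sign0.
by rewrite !(m0, n0, b0, addr0, add0r, kantor_in0, kantor_s0).
Qed.

Lemma kantor_mul_s_in (x y : P) :
  kantor_mul mul br (kantor_s x) (kantor_in y) = kantor_s (mul x y).
Proof.
have [m0 n0 _] := superalgebra_mul0 mulP.
have [b0 _ _] := superalgebra_mul0 brP.
rewrite /kantor_mul !kantor_compE ?parity_sign0.
by rewrite !(m0, n0, b0, addr0, add0r, kantor_in0, kantor_s0).
Qed.

Lemma kantor_mul_in_s (i : bool) (x y : P) : homog i x ->
  kantor_mul mul br (kantor_in x) (kantor_s y)
  = (-1) ^+ i *: kantor_s (mul x y).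
Proof.
move=> xi; have [m0 n0 mZ] := superalgebra_mul0 mulP.
have [_ b0 _] := superalgebra_mul0 brP.
have -> : (-1) ^+ i *: kantor_s (mul x y) = kantor_s (mul (parity_sign x) y).
  rewrite (parity_sign_homog xi) mZ.
  by congr (_, _); congr (_, _); rewrite /= scaler0.
rewrite /kantor_mul !kantor_compE ?parity_sign0.
by rewrite !(m0, n0, b0, addr0, add0r, kantor_in0, kantor_s0).
Qed.

Lemma kantor_mul_s_s (i : bool) (x y : P) : homog i x ->
  kantor_mul mul br (kantor_s x) (kantor_s y)
  = (-1) ^+ i *: kantor_in (br x y).
Proof.
move=> xi; have [m0 n0 _] := superalgebra_mul0 mulP.
have [_ _ bZ] := superalgebra_mul0 brP.
have -> : (-1) ^+ i *: kantor_in (br x y) = kantor_in (br (parity_sign x) y).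
  rewrite (parity_sign_homog xi) bZ.
  by congr (_, _); congr (_, _); rewrite /= scaler0.
rewrite /kantor_mul !kantor_compE ?parity_sign0.
by rewrite !(m0, n0, addr0, add0r, kantor_in0, kantor_s0).
Qed.

End Products.
End KantorDouble.

(* Main.v *)
Require Import Defs.
From HB Require Import structures.
From mathcomp Require Import all_boot all_order all_algebra ring.

(** Write J(P) = P + P^s, and let x^e be x or x^s according to the bit e.  On
    these generators the four product rules of the Kantor double become one,
      x^e * y^f = (-1)^(i f) (x op y)^(e + f),
    where i is the parity of x and op is the bracket if e = f = 1 and the
    product of P otherwise ([kantor_mul_elt]).  Bilinearity, the grading and
    supercommutativity of * are then immediate, and as the Jordan identity is
    linear in its four arguments it only has to be checked on generators
    x^e, y^f, z^g, w^h with x, y, z, w homogeneous.  There it reads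
    (signed quantity of P)^(e + f + g + h) = 0.  Its left-hand side is
    invariant under rotation of x, y, z, so what counts is how many of x^e,
    y^f, z^g are in P^s, and whether w^h is.

    - If at most one of the four is in P^s, or exactly x^s, y^s, z^s are, no
      bracket acts on a product and the three summands vanish one by one, by
      associativity and supercommutativity ([jterm_000], [jterm_1000],
      [jterm_1110]).
    - The other cases follow from four consequences of the transposed Leibniz
      rule 2 x{y,z} = {xy,z} + {y,xz} (signs omitted, sums over rotations of x, y, z):
        sum x{y,z} = 0                              ([mul_br_cycle])
        {xy,zw} + {xz,yw} = 2 yz{x,w}               ([br_mul_swap])
        sum {h{x,y},z} = 0                          ([br_mul_br_cycle])
        sum {x,y}{z,w} = 0                          ([mul_br_br_cycle])
      The second one settles x^s,w^s and x^s,y^s ([jterm_1001],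
      [jterm_1100]), the first one x^s,y^s,w^s ([jterm_1101]), and the last
      two, which are where the Jacobi identity enters, settle the case of all
      four in P^s ([jterm_1111]).

    Each of these identities is a linear combination of known equations, after
    at most a division by 2.  The coefficients are displayed in the proofs;
    that the combination is right is then decided in each of the at most 16
    cases for the parities, where all signs are concrete, by the ring tactic
    in a trivial extension of the base field. *)

Set Implicit Arguments.
Unset Strict Implicit.
Unset Printing Implicit Defensive.
Import GRing.Theory.
Local Open Scope ring_scope.

(** * Linear combinations of equations in a module *)

(** The trivial (square-zero) extension of F by V: V embeds additively in a
    commutative ring, so that an equation between integral linear combinations
    of elements of V can be decided by the ring tactic. *)
Section TrivialExtension.
Variables (F : fieldType) (V : lmodType F).
Definition triv_ext : Type := F * V.
HB.instance Definition _ := GRing.Zmodule.on triv_ext.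
Definition triv_one : triv_ext := (1, 0).
Definition triv_mul (a b : triv_ext) : triv_ext :=
  (a.1 * b.1, a.1 *: b.2 + b.1 *: a.2).

Fact triv_mulA : associative triv_mul.
Proof.
move=> [a u] [b v] [c w]; rewrite /triv_mul /=; congr (_, _); first exact: mulrA.
by rewrite !scalerDr !scalerA addrA [c * a]mulrC [c * b]mulrC.
Qed.

Fact triv_mulC : commutative triv_mul.
Proof. by move=> a b; rewrite /triv_mul addrC mulrC. Qed.

Fact triv_mul1 : left_id triv_one triv_mul.
Proof. by move=> [a u]; rewrite /triv_mul /= mul1r scale1r scaler0 addr0. Qed.

Fact triv_mulDl : left_distributive triv_mul +%R.
Proof.
move=> [a u] [b v] [c w]; rewrite /triv_mul /=; congr (_, _); first exact: mulrDl.
by rewrite scalerDl scalerDr /= addrACA.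
Qed.

Fact triv_one0 : triv_one != 0.
Proof. by apply/eqP => -[] /eqP; rewrite oner_eq0. Qed.

HB.instance Definition _ := GRing.Zmodule_isComNzRing.Build triv_ext
  triv_mulA triv_mulC triv_mul1 triv_mulDl triv_one0.

Definition triv_inj (v : V) : triv_ext := (0, v).

Fact triv_inj_additive : zmod_morphism triv_inj.
Proof. by move=> u v; rewrite /triv_inj; congr (_, _); rewrite /= subr0. Qed.

HB.instance Definition _ := GRing.isZmodMorphism.Build V triv_ext triv_inj
  triv_inj_additive.

Lemma triv_injI : injective triv_inj. Proof. by move=> u v []. Qed.
End TrivialExtension.

Section Combination.
Variables (F : fieldType) (V : lmodType F).

(** In the uses of this lemma a = b is a linear combination of known equations,
    given as a term built with [eq_addr2] and [eq_scale]. *)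
Lemma eq_from (a b l r : V) : a = b -> l - r = a - b -> l = r.
Proof. by move=> -> /eqP; rewrite subrr subr_eq0 => /eqP. Qed.

Lemma eq_from_half (a b l r : V) : 2%N \notin [pchar F] ->
  a = b -> (l - r) *+ 2 = a - b -> l = r.
Proof.
move=> hF -> /eqP; rewrite subrr -scaler_nat scaler_eq0 subr_eq0.
case/orP=> [two0|/eqP//]; case/negP: hF.
by rewrite inE.
Qed.

Lemma eq_addr2 (a b c d : V) : a = b -> c = d -> a + c = b + d.
Proof. by move=> -> ->. Qed.

Lemma eq_scale (c : F) (a b : V) : a = b -> c *: a = c *: b.
Proof. by move=> ->. Qed.

End Combination.

(** Closes an equation between linear combinations whose coefficients are
    integers or signs (-1) ^+ b with b a concrete boolean expression. *)
Ltac abelian :=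
  rewrite /= ?(expr0, expr1, mulr1, mulrN, scale1r, scaleNr, scaler_nat) /=;
  apply: triv_injI; ring.

(** * Superalgebras *)

Section Superalgebra.
Variables (F : fieldType) (V0 V1 : lmodType F) (m : V0 * V1 -> V0 * V1 -> V0 * V1).
Hypothesis mP : superalgebra m.

Lemma algZl c x y : m (c *: x) y = c *: m x y.
Proof. by case: (superalgebra_mul0 mP). Qed.

Lemma alg0l x : m 0 x = 0. Proof. by case: (superalgebra_mul0 mP). Qed.

Lemma alg0r x : m x 0 = 0. Proof. by case: (superalgebra_mul0 mP). Qed.

Lemma algZr c x y : m x (c *: y) = c *: m x y.
Proof.
have [_ hr] := superalgebra_bilinear mP.
by have := hr x c y 0; rewrite /= alg0r !addr0.
Qed.

Lemma algDl x y z : m (x + y) z = m x z + m y z.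
Proof.
by have [h _] := superalgebra_bilinear mP; have := h z 1 x y; rewrite /= !scale1r.
Qed.

Lemma algDr x y z : m x (y + z) = m x y + m x z.
Proof.
by have [_ h] := superalgebra_bilinear mP; have := h x 1 y z; rewrite /= !scale1r.
Qed.
End Superalgebra.

Lemma homogD (F : fieldType) (V0 V1 : lmodType F) p (u v : V0 * V1) :
  homog p u -> homog p v -> homog p (u + v).
Proof. by case: p => /= hu hv; rewrite /homog /= hu hv addr0. Qed.

Lemma homogZ (F : fieldType) (V0 V1 : lmodType F) p (c : F) (u : V0 * V1) :
  homog p u -> homog p (c *: u).
Proof. by case: p => /= hu; rewrite /homog /= hu scaler0. Qed.

Section JordanTerm.
Variables (F : fieldType) (V0 V1 : lmodType F).
Local Notation V := (V0 * V1)%type.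
Variable m : V -> V -> V.

(** One of the three summands of the Jordan identity; the other two are its
    rotations. *)
Definition jordan_term (p q r : bool) (x y z w : V) : V :=
  (-1) ^+ (p && r) *: super_commutator (p (+) q) r (m (m x y)) (m z) w.

Lemma jordan_termD p q r : superalgebra m ->
  [/\ forall x x' y z w, jordan_term p q r (x + x') y z w
        = jordan_term p q r x y z w + jordan_term p q r x' y z w,
      forall x y y' z w, jordan_term p q r x (y + y') z w
        = jordan_term p q r x y z w + jordan_term p q r x y' z w,
      forall x y z z' w, jordan_term p q r x y (z + z') w
        = jordan_term p q r x y z w + jordan_term p q r x y z' w
    & forall x y z w w', jordan_term p q r x y z (w + w')
        = jordan_term p q r x y z w + jordan_term p q r x y z w'].
Proof.
move=> mP.
have comb (c d : F) (a a' b b' : V) :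
    c *: (a + a' - d *: (b + b')) = c *: (a - d *: b) + c *: (a' - d *: b').
  by rewrite -scalerDr addrACA -opprD -scalerDr.
by split=> *; rewrite /jordan_term /super_commutator /= !(algDl mP, algDr mP) comb.
Qed.
End JordanTerm.

(** * Identities of transposed Poisson superalgebras *)

Section TPoisson.
Variables (F : fieldType) (hF : 2%N \notin [pchar F]).
Variables (P0 P1 : lmodType F).
Local Notation P := (P0 * P1)%type.
Variables (mul br : P -> P -> P).
Hypothesis hP : transposed_Poisson_superalgebra mul br.

Local Notation sg i j := ((-1) ^+ (i && j) : F).

Let mulP := tPoisson_superalgebra hP.
Let brP := Lie_superalgebra_superalgebra (tPoisson_Lie hP).
Let mulA := tPoisson_assoc hP.

Let gr i j x y : homog i x -> homog j y -> homog (i (+) j) (mul x y).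
Proof. exact: (superalgebra_graded mulP). Qed.
Let grb i j x y : homog i x -> homog j y -> homog (i (+) j) (br x y).
Proof. exact: (superalgebra_graded brP). Qed.
Let leibniz := tPoisson_Leibniz hP.
Let jacobi := Lie_superalgebra_jacobi (tPoisson_Lie hP).

Lemma supermulC i j x y : homog i x -> homog j y -> mul y x = sg i j *: mul x y.
Proof. by move=> hx hy; rewrite (tPoisson_supercomm hP hy hx) andbC. Qed.

Lemma superbrC i j x y : homog i x -> homog j y -> br y x = - (sg i j *: br x y).
Proof.
by move=> hx hy; rewrite (Lie_superalgebra_anticomm (tPoisson_Lie hP) hy hx) andbC.
Qed.

Let lin := (algDl mulP, algDr mulP, algDl brP, algDr brP,
            algZl mulP, algZr mulP, algZl brP, algZr brP,
            alg0l mulP, alg0r mulP, alg0l brP, alg0r brP).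

(** Add the transposed Leibniz rules for 2 x{y,z}, 2 y{z,x} and 2 z{x,y}: the
    right-hand sides cancel by antisymmetry of the bracket. *)
Lemma mul_br_cycle i j k x y z : homog i x -> homog j y -> homog k z ->
  sg i k *: mul x (br y z) + sg j i *: mul y (br z x) + sg k j *: mul z (br x y)
  = 0.
Proof.
move=> hx hy hz.
apply: (eq_from_half hF
  (eq_addr2 (eq_scale (sg i k) (leibniz hx hy hz))
  (eq_addr2 (eq_scale (sg j i) (leibniz hy hz hx))
        (eq_scale (sg k j) (leibniz hz hx hy))))).
rewrite (supermulC hx hy) (supermulC hx hz) (supermulC hy hz) !lin.
rewrite (superbrC (gr hx hy) hz) (superbrC (gr hx hz) hy) (superbrC (gr hy hz) hx).
by destruct i, j, k; abelian.
Qed.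

(** Expand 4 yz{x,w} by applying the rule to z and then to y.  Two of the four
    resulting brackets are those of the left-hand side; the other two add up to
    2 yz{x,w} by the rule for the product yz. *)
Lemma br_mul_swap i j k l x y z w :
    homog i x -> homog j y -> homog k z -> homog l w ->
  br (mul x y) (mul z w) + sg j k *: br (mul x z) (mul y w)
  = (sg i j * sg i k) *: (mul (mul y z) (br x w) *+ 2).
Proof.
move=> hx hy hz hw.
apply: (eq_from (eq_scale (- (sg i j * sg i k))
  (eq_addr2 (congr1 (fun u => mul y u *+ 2) (leibniz hz hx hw))
  (eq_addr2 (leibniz hy (gr hz hx) hw)
  (eq_addr2 (eq_scale (sg i k) (leibniz hy hx (gr hz hw)))
        (eq_scale (-1) (leibniz (gr hy hz) hx hw))))))).
rewrite !lin !mulA (supermulC hx hz) (supermulC hx hy) !lin.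
by destruct i, j, k, l; abelian.
Qed.

(** Let A be the left-hand side and B the sum of the {{x,y},hz}.  The rule and
    the Jacobi identity give A + B = sum 2 h{{x,y},z} = 0.  Expanding
    2 h{x,y} = {hx,y} + {x,hy} inside A, the Jacobi identities for (hx,y,z),
    (hy,z,x) and (hz,x,y) give 2 A + B = 0. *)
Lemma br_mul_br_cycle i j k l h x y z :
    homog l h -> homog i x -> homog j y -> homog k z ->
  sg i k *: br (mul h (br x y)) z + sg j i *: br (mul h (br y z)) x
  + sg k j *: br (mul h (br z x)) y = 0.
Proof.
move=> hh hx hy hz.
have E (i' j' k' : bool) x' y' z'
  (hx' : homog i' x') (hy' : homog j' y') (hz' : homog k' z') :=
  eq_addr2 (congr1 (br^~ z') (leibniz hh hx' hy'))
  (leibniz hh (grb hx' hy') hz').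
apply: (eq_from
  (eq_addr2 (eq_addr2 (eq_scale (sg i k) (E _ _ _ _ _ _ hx hy hz))
  (eq_addr2 (eq_scale (sg j i) (E _ _ _ _ _ _ hy hz hx))
        (eq_scale (sg k j) (E _ _ _ _ _ _ hz hx hy))))
  (eq_addr2 (eq_addr2 (eq_scale (sg l k) (jacobi (gr hh hx) hy hz))
  (eq_addr2 (eq_scale (sg l i) (jacobi (gr hh hy) hz hx))
        (eq_scale (sg l j) (jacobi (gr hh hz) hx hy))))
  (congr1 (fun u => - mul h u *+ 2) (jacobi hx hy hz))))).
rewrite !lin.
by destruct i, j, k, l; abelian.
Qed.

(** Expanding 2 {z,w}{x,y} with {z,w} as the multiplier gives terms
    {x{z,w},y} for the six orders of x, y, z.  By [mul_br_cycle] for x, z, w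
    these combine in pairs to terms {w{x,z},y}, whose sum vanishes by
    [br_mul_br_cycle]. *)
Lemma mul_br_br_cycle i j k l x y z w :
    homog i x -> homog j y -> homog k z -> homog l w ->
  sg i k *: mul (br x y) (br z w) + sg j i *: mul (br y z) (br x w)
  + sg k j *: mul (br z x) (br y w) = 0.
Proof.
move=> hx hy hz hw.
have E (i' j' k' : bool) x' y' z'
  (hx' : homog i' x') (hy' : homog j' y') (hz' : homog k' z') :=
  eq_addr2 (eq_scale (sg i' k' * sg (i' (+) j') (k' (+) l))
    (leibniz (grb hz' hw) hx' hy'))
  (eq_scale (sg i' k' * sg j' (k' (+) l) * sg i' l)
   (congr1 (br^~ y') (mul_br_cycle hx' hz' hw))).
apply: (eq_from_half hF
  (eq_addr2 (eq_addr2 (E _ _ _ _ _ _ hx hy hz)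
  (eq_addr2 (E _ _ _ _ _ _ hy hz hx) (E _ _ _ _ _ _ hz hx hy)))
  (eq_scale (sg k l * sg j l * sg l i) (br_mul_br_cycle hw hx hy hz)))).
rewrite (supermulC (grb hz hw) (grb hx hy)) (supermulC (grb hx hw) (grb hy hz)).
rewrite (supermulC (grb hy hw) (grb hz hx)).
rewrite (supermulC hx (grb hz hw)) (supermulC hy (grb hz hw)).
rewrite (supermulC hy (grb hx hw)) (supermulC hz (grb hx hw)).
rewrite (supermulC hx (grb hy hw)) (supermulC hz (grb hy hw)).
rewrite (superbrC hx hw) (superbrC hy hw) (superbrC hz hw).
rewrite (superbrC hx hy) (superbrC hy hz) (superbrC hz hx).
rewrite !lin.
rewrite -!scaleNr !lin.
rewrite (superbrC (gr hy (grb hz hw)) hx) (superbrC (gr hz (grb hx hw)) hy).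
rewrite (superbrC (gr hx (grb hy hw)) hz).
by destruct i, j, k, l; abelian.
Qed.

Lemma supermulCA i j x y z : homog i x -> homog j y ->
  mul y (mul x z) = sg i j *: mul x (mul y z).
Proof. by move=> hx hy; rewrite !mulA (supermulC hx hy) !lin. Qed.

(** * The Jordan identity on generators of the Kantor double *)

Definition op (e : bool) := if e then br else mul.

(** For generators x^e, y^f, z^g, w^h of the Kantor double the summand of the
    Jordan identity at (x^e, y^f, z^g; w^h) is (jterm ...)^(e+f+g+h); see
    [jordan_term_elt].  The exponents of -1 come from the Jordan
    identity, from the supercommutator in it and from the product rule. *)
Definition jterm (e f g h i j k : bool) (x y z w : P) : P :=
  (-1) ^+ ((e (+) i) && (g (+) k)) *: ((-1) ^+ (i && f) *:
   ((-1) ^+ (k && h) *: ((-1) ^+ ((i (+) j) && (g (+) h)) *: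
      op ((e (+) f) && (g (+) h)) (op (e && f) x y) (op (g && h) z w)))
   - (-1) ^+ ((e (+) i (+) (f (+) j)) && (g (+) k)) *: ((-1) ^+ (i && f) *:
     ((-1) ^+ ((i (+) j) && h) *: ((-1) ^+ (k && (e (+) f (+) h)) *:
      op (g && (e (+) f (+) h)) z (op ((e (+) f) && h) (op (e && f) x y) w))))).

(** The digits in the names of the lemmas say which of x, y, z and w carry
    the exponent s. *)
Section Identities.
Variables (i j k l : bool) (x y z w : P).
Hypotheses (hx : homog i x) (hy : homog j y) (hz : homog k z) (hw : homog l w).

Lemma jterm_000 h :
  jterm false false false h i j k x y z w + jterm false false false h j k i y z x w
  + jterm false false false h k i j z x y w = 0.
Proof.
rewrite /jterm /op !andbF /=.
rewrite (supermulCA w (gr hx hy) hz) (supermulCA w (gr hy hz) hx).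
rewrite (supermulCA w (gr hz hx) hy).
by clear; destruct h, i, j, k; abelian.
Qed.

Lemma jterm_1000 :
  jterm true false false false i j k x y z w + jterm false false true false j k i y z x w
  + jterm false true false false k i j z x y w = 0.
Proof.
rewrite /jterm /op /=.
rewrite (supermulCA w (gr hx hy) hz) (supermulCA w (gr hy hz) hx).
rewrite (supermulCA w (gr hz hx) hy).
by clear; destruct i, j, k; abelian.
Qed.

(** Modulo signs this is {xy,zw} - z{xy,w} + yz{x,w} - {x,yzw} + {zx,yw} - y{zx,w}.
    After doubling, the rules for 2 z{xy,w}, 2 y{zx,w} and 2 yz{x,w} reduce it
    to [br_mul_swap]. *)
Lemma jterm_1001 :
  jterm true false false true i j k x y z w + jterm false false true true j k i y z x w
  + jterm false true false true k i j z x y w = 0.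
Proof.
rewrite /jterm /op /=.
(* c and c' are the signs of {xy,zw} and {zx,yw} in the identity. *)
pose c : F := (-1) ^+ (i (+) j) * sg i k.
pose c' : F := (-1) ^+ (i (+) j) * sg j k.
apply: (eq_from_half hF
  (eq_addr2 (eq_scale c (br_mul_swap hx hy hz hw))
  (eq_addr2 (eq_scale (- c * sg k (i (+) j)) (leibniz hz (gr hx hy) hw))
  (eq_addr2 (eq_scale (- c' * sg j (k (+) i)) (leibniz hy (gr hz hx) hw))
        (eq_scale (c * sg i j * sg i k)
          (congr1 (fun u => u *+ 2) (leibniz (gr hy hz) hx hw))))))).
rewrite (supermulC (gr hx hy) hz) (mulA y z x) (supermulC hx (gr hy hz)) (mulA x y z).
rewrite (supermulC hx hz) !lin {}/c {}/c'.
by clear; destruct i, j, k; abelian.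
Qed.

(** Modulo signs this is {xz,yw} + {xw,yz} - {x,yzw} - {xzw,y}: by
    [br_mul_swap] the first two terms make 2 zw{x,y}, and so do the last two by
    the transposed Leibniz rule. *)
Lemma jterm_1100 :
  jterm true true false false i j k x y z w + jterm true false true false j k i y z x w
  + jterm false true true false k i j z x y w = 0.
Proof.
rewrite /jterm /op /=.
rewrite (supermulCA w (grb hx hy) hz).
(* The sign of {zx,yw} in the identity, corrected for the order of the
   factors in {xz,wy}. *)
pose c : F := (-1) ^+ ((k && j) (+) k (+) i) * sg i k * sg j l.
apply: (eq_from
  (eq_addr2 (eq_scale c (br_mul_swap hx hz hw hy))
        (eq_scale (c * sg i k * sg i l) (leibniz (gr hz hw) hx hy)))).
rewrite (supermulC hx (gr hz hw)) (mulA x z w) (supermulC hy (gr hz hw)) (mulA y z w).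
rewrite (supermulC hy hz) (supermulC hy hw) (supermulC hx hz) !lin.
rewrite (superbrC (gr hx hw) (gr hy hz)) (superbrC (gr (gr hx hz) hw) hy) {}/c.
by clear; destruct i, j, k, l; abelian.
Qed.

(** Modulo signs this is zx{y,w} + y{zx,w} - yz{x,w} - x{yz,w}.  Rotating the
    second and the fourth term by [mul_br_cycle] leaves
    2 z(x{y,w} - y{x,w}) + w({zx,y} + {x,yz}), where the last factor is
    2 z{x,y}, so that z times [mul_br_cycle] for x, y, w applies again. *)
Lemma jterm_1101 :
  jterm true true false true i j k x y z w + jterm true false true true j k i y z x w
  + jterm false true true true k i j z x y w = 0.
Proof.
rewrite /jterm /op /=.
rewrite (supermulCA w (grb hx hy) hz).
(* a, b and c are the signs of y{zx,w}, x{yz,w} and zx{y,w} in the identity,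
   divided by the sign of the like term in the instance of mul_br_cycle. *)
pose a : F := (-1) ^+ ((i && j) (+) j) * sg j l.
pose b : F := (-1) ^+ (~~ ((k && i) (+) j)) * sg i l.
pose c : F := (-1) ^+ ((k && j) (+) j) * sg i l.
apply: (eq_from
  (eq_addr2 (eq_scale a (mul_br_cycle hy (gr hz hx) hw))
  (eq_addr2 (eq_scale b (mul_br_cycle hx (gr hy hz) hw))
  (eq_addr2 (eq_scale c (congr1 (fun u => mul z u *+ 2) (mul_br_cycle hx hy hw)))
        (eq_scale (- a * sg l (k (+) i) * sg j (k (+) i))
          (congr1 (mul w) (leibniz hz hx hy))))))).
rewrite !lin !mulA (supermulC hz hw) (supermulC hy hz).
rewrite !lin.
rewrite (superbrC (gr hz hx) hy) (superbrC hx hw) (superbrC hy hw).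
rewrite -!scaleNr !lin {}/a {}/b {}/c.
by clear; destruct i, j, k, l; abelian.
Qed.

Lemma jterm_1110 :
  jterm true true true false i j k x y z w + jterm true true true false j k i y z x w
  + jterm true true true false k i j z x y w = 0.
Proof.
rewrite /jterm /op /=.
rewrite (supermulCA w (grb hx hy) hz) (supermulCA w (grb hy hz) hx).
rewrite (supermulCA w (grb hz hx) hy).
by clear; destruct i, j, k; abelian.
Qed.

(** Modulo signs this is the sum of [mul_br_br_cycle] and of [br_mul_br_cycle]
    for the multiplier w. *)
Lemma jterm_1111 :
  jterm true true true true i j k x y z w + jterm true true true true j k i y z x w
  + jterm true true true true k i j z x y w = 0.
Proof.
rewrite /jterm /op /=.
apply: (eq_from
  (eq_addr2 (eq_scale (-1) (mul_br_br_cycle hx hy hz hw))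
        (eq_scale (- (sg i l * sg j l * sg k l)) (br_mul_br_cycle hw hx hy hz)))).
rewrite (supermulC hw (grb hx hy)) (supermulC hw (grb hy hz)).
rewrite (supermulC hw (grb hz hx)) !lin.
rewrite (superbrC (gr hw (grb hx hy)) hz) (superbrC (gr hw (grb hy hz)) hx).
rewrite (superbrC (gr hw (grb hz hx)) hy).
by clear; destruct i, j, k, l; abelian.
Qed.
End Identities.

Lemma jterm_cycle e f g h i j k l x y z w :
    homog i x -> homog j y -> homog k z -> homog l w ->
  jterm e f g h i j k x y z w + jterm f g e h j k i y z x w
  + jterm g e f h k i j z x y w = 0.
Proof.
have rot (u v t : P) : u + v + t = 0 -> t + u + v = 0 by rewrite addrC addrA.
move=> hx hy hz hw; case: e f g h => [] [] [] [].
- exact: jterm_1111 hx hy hz hw.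
- exact: jterm_1110 w hx hy hz.
- exact: jterm_1101 hx hy hz hw.
- exact: jterm_1100 hx hy hz hw.
- exact: rot _ _ _ (rot _ _ _ (jterm_1101 hz hx hy hw)).
- exact: rot _ _ _ (rot _ _ _ (jterm_1100 hz hx hy hw)).
- exact: jterm_1001 hx hy hz hw.
- exact: jterm_1000 w hx hy hz.
- exact: rot _ _ _ (jterm_1101 hy hz hx hw).
- exact: rot _ _ _ (jterm_1100 hy hz hx hw).
- exact: rot _ _ _ (jterm_1001 hy hz hx hw).
- exact: rot _ _ _ (jterm_1000 w hy hz hx).
- exact: rot _ _ _ (rot _ _ _ (jterm_1001 hz hx hy hw)).
- exact: rot _ _ _ (rot _ _ _ (jterm_1000 w hz hx hy)).
- exact: jterm_000 w hx hy hz _.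
- exact: jterm_000 w hx hy hz _.
Qed.
End TPoisson.

(** * The Kantor double *)

Section KantorGenerators.
Variables (F : fieldType) (P0 P1 : lmodType F).
Local Notation P := (P0 * P1)%type.
Local Notation J := ((P0 * P1) * (P1 * P0))%type.

Definition kantor_elt (e : bool) (x : P) : J :=
  if e then kantor_s x else kantor_in x.

Lemma kantor_elt_is_linear e : linear (kantor_elt e).
Proof.
by case: e => c x y; congr (_, _); congr (_, _); rewrite /= scaler0 addr0.
Qed.
HB.instance Definition _ e :=
  GRing.isLinear.Build F P J _ (kantor_elt e) (kantor_elt_is_linear e).

Lemma homog_kantor_elt e i x : homog i x -> homog (e (+) i) (kantor_elt e x).
Proof. by case: e => hx; [exact: homog_kantor_s | exact: homog_kantor_in]. Qed.

(** A property stable under sums holds for all elements of a given parity as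
    soon as it holds for the generators of that parity; this is how the
    multilinear identities are reduced to generators. *)
Lemma homog_kantor_ind p (Q : J -> Prop) :
    (forall u v, Q u -> Q v -> Q (u + v)) ->
    (forall e i x, homog i x -> e (+) i = p -> Q (kantor_elt e x)) ->
  forall u, homog p u -> Q u.
Proof.
move=> QD Qelt u hu; rewrite (kantor_decomp u).
apply: QD.
  by apply: (Qelt false p) => //; case: (p) hu; rewrite /homog /= => ->.
apply: (Qelt true (~~ p)); last by rewrite addTb negbK.
by case: (p) hu; rewrite /homog /= => ->.
Qed.

Lemma kantor_ind (Q : J -> Prop) :
    (forall u v, Q u -> Q v -> Q (u + v)) ->
    (forall e i x, homog i x -> Q (kantor_elt e x)) -> forall u, Q u.
Proof.
move=> QD Qelt u.
have -> : u = (u.1, 0) + (0, u.2).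
  by case: u => a b; congr (_, _); rewrite /= ?addr0 ?add0r.
have Qp p v : homog p v -> Q v.
  by apply: homog_kantor_ind => // e i x hx _; exact: Qelt hx.
by apply: QD; [exact: (Qp false) | exact: (Qp true)].
Qed.
End KantorGenerators.

Section KantorDouble.
Variables (F : fieldType) (hF : 2%N \notin [pchar F]).
Variables (P0 P1 : lmodType F).
Local Notation P := (P0 * P1)%type.
Local Notation J := ((P0 * P1) * (P1 * P0))%type.
Variables (mul br : P -> P -> P).
Hypothesis hP : transposed_Poisson_superalgebra mul br.
Local Notation km := (kantor_mul mul br).
Local Notation op := (op mul br).
Local Notation jordan_term := (jordan_term km).
Let mulP := tPoisson_superalgebra hP.
Let brP := Lie_superalgebra_superalgebra (tPoisson_Lie hP).

Lemma homog_op e i j x y :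
  homog i x -> homog j y -> homog (i (+) j) (op e x y).
Proof.
by case: e; [apply: (superalgebra_graded brP) | apply: (superalgebra_graded mulP)].
Qed.

Lemma kantor_mul_elt e f i x y : homog i x ->
  km (kantor_elt e x) (kantor_elt f y)
  = (-1) ^+ (i && f) *: kantor_elt (e (+) f) (op (e && f) x y).
Proof.
move=> hx; case: e f => [] [] /=; rewrite ?(andbT, andbF) ?expr0 ?scale1r.
- exact: kantor_mul_s_s.
- exact: kantor_mul_s_in.
- exact: kantor_mul_in_s.
- exact: kantor_mul_in_in.
Qed.

Lemma parity_sign_is_linear : linear (@parity_sign F P0 P1).
Proof.
by move=> c [a b] [a' b']; congr (_, _); rewrite /= opprD scalerN.
Qed.

Lemma kantor_mul_bilinear : bilinear_for *:%R *:%R km.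
Proof.
have inD : linear (@kantor_in F P0 P1) := kantor_elt_is_linear false.
have sD : linear (@kantor_s F P0 P1) := kantor_elt_is_linear true.
have comb (W : lmodType F) (c : F) (a a' b b' : W) :
  c *: a + a' + (c *: b + b') = c *: (a + b) + (a' + b').
  by rewrite scalerDr addrACA.
have fstD c (v w : J) : kantor_fst (c *: v + w) = c *: kantor_fst v + kantor_fst w by [].
have sndD c (v w : J) : kantor_snd (c *: v + w) = c *: kantor_snd v + kantor_snd w by [].
split=> u c v w; rewrite /kantor_mul fstD sndD.
  rewrite !parity_sign_is_linear !(algDl mulP, algDl brP, algZl mulP, algZl brP) !comb.
  by rewrite inD sD comb.
rewrite !(algDr mulP, algDr brP, algZr mulP, algZr brP) !comb.
by rewrite inD sD comb.
Qed.

Lemma kantor_superalgebra : superalgebra km.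
Proof.
have [hl hr] := kantor_mul_bilinear.
split; first exact: kantor_mul_bilinear.
move=> p q u v hu hv.
move: u hu; apply: homog_kantor_ind => [u u' | e i x hx <-].
  move=> h h'; have := hl v 1 u u'; rewrite /= !scale1r => ->.
  exact: homogD.
move: v hv; apply: homog_kantor_ind => [v v' | f j y hy <-].
  move=> h h'; have := hr (kantor_elt e x) 1 v v'; rewrite /= !scale1r => ->.
  exact: homogD.
rewrite (kantor_mul_elt _ _ _ hx) addbACA; apply: homogZ.
exact/homog_kantor_elt/homog_op.
Qed.

Lemma opC e i j x y : homog i x -> homog j y ->
  op e x y = (-1) ^+ (e (+) (i && j)) *: op e y x.
Proof.
case: e => hx hy /=.
  by rewrite signrN scaleNr; exact: (Lie_superalgebra_anticomm (tPoisson_Lie hP) hx hy).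
exact: (tPoisson_supercomm hP hx hy).
Qed.

Lemma kantor_supercomm : supercommutative km.
Proof.
pose kS := kantor_superalgebra.
move=> p q u v hu hv.
move: u hu; apply: homog_kantor_ind => [u u' h h' | e i x hx <-].
  by rewrite (algDl kS) (algDr kS) h h' -scalerDr.
move: v hv; apply: homog_kantor_ind => [v v' h h' | f j y hy <-].
  by rewrite (algDl kS) (algDr kS) h h' -scalerDr.
rewrite (kantor_mul_elt _ _ _ hx) (kantor_mul_elt _ _ _ hy) (opC _ hx hy).
rewrite [f && e]andbC [f (+) e]addbC linearZ !scalerA -!signr_addb.
by congr (_ ^+ _ *: _); case: e f i j {hx hy} => [] [] [] [].
Qed.

Lemma jordan_term_elt e f g h i j k x y z w :
    homog i x -> homog j y -> homog k z ->
  jordan_term (e (+) i) (f (+) j) (g (+) k)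
    (kantor_elt e x) (kantor_elt f y) (kantor_elt g z) (kantor_elt h w)
  = kantor_elt (e (+) f (+) g (+) h) (jterm mul br e f g h i j k x y z w).
Proof.
move=> hx hy hz; pose kS := kantor_superalgebra.
rewrite /jordan_term /super_commutator /jterm /=.
have hxy := homog_op (e && f) hx hy.
rewrite (kantor_mul_elt e f y hx) (kantor_mul_elt g h w hz).
rewrite !(algZl kS, algZr kS).
rewrite (kantor_mul_elt _ _ _ hxy) (kantor_mul_elt _ _ _ hxy).
rewrite !(algZl kS, algZr kS) (kantor_mul_elt _ _ _ hz).
have -> : e (+) f (+) (g (+) h) = e (+) f (+) g (+) h by rewrite addbA.
have -> : g (+) (e (+) f (+) h) = e (+) f (+) g (+) h.
  by case: (e) (f) (g) (h) => [] [] [] [].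
have KZ c b t : c *: kantor_elt b t = kantor_elt b (c *: t) by rewrite linearZ.
have KB b t u : kantor_elt b t - kantor_elt b u = kantor_elt b (t - u).
  by rewrite linearB.
by rewrite !KZ KB KZ.
Qed.

Lemma kantor_jordan : super_Jordan_identity km.
Proof.
move=> p q r X Y Z hX hY hZ W.
have comb (a b c a' b' c' : J) : a + b + c = 0 -> a' + b' + c' = 0 ->
    (a + a') + (b + b') + (c + c') = 0.
  by move=> h h'; rewrite (addrACA a) (addrACA (a + b)) h h' addr0.
(* X is the first argument of the first summand, the third one of the second
   and the second one of the third; hence the mix of additivity rules D1, E3,
   G2, and similarly for Y and Z. *)
change (jordan_term p q r X Y Z W + jordan_term q r p Y Z X W
        + jordan_term r p q Z X Y W = 0).
have [D1 D2 D3 D4] := jordan_termD p q r kantor_superalgebra.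
have [E1 E2 E3 E4] := jordan_termD q r p kantor_superalgebra.
have [G1 G2 G3 G4] := jordan_termD r p q kantor_superalgebra.
elim/kantor_ind: W => [W W' h h' | h l w hw].
  by rewrite D4 E4 G4; exact: comb.
move: X hX; apply: homog_kantor_ind => [X X' hX hX' | e i x hx hp].
  by rewrite D1 E3 G2; exact: comb.
move: Y hY; apply: homog_kantor_ind => [Y Y' hY hY' | f j y hy hq].
  by rewrite D2 E1 G3; exact: comb.
move: Z hZ; apply: homog_kantor_ind => [Z Z' hZ hZ' | g k z hz hr].
  by rewrite D3 E2 G1; exact: comb.
rewrite -hp -hq -hr !jordan_term_elt //.
have -> : f (+) g (+) e (+) h = e (+) f (+) g (+) h.
  by case: (e) (f) (g) (h) => [] [] [] [].
have -> : g (+) e (+) f (+) h = e (+) f (+) g (+) h.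
  by case: (e) (f) (g) (h) => [] [] [] [].
by rewrite -!linearD (jterm_cycle hF hP e f g h hx hy hz hw) linear0.
Qed.
End KantorDouble.

Unset Implicit Arguments.

Theorem theorem24 (F : fieldType) (hF : 2%N \notin [pchar F])
    (P0 P1 : lmodType F) (mul br : P0 * P1 -> P0 * P1 -> P0 * P1)
    (hP : transposed_Poisson_superalgebra mul br) :
  Jordan_superalgebra (kantor_mul mul br).
Proof.
split; [exact: kantor_superalgebra | exact: kantor_supercomm | exact: kantor_jordan].
Qed.
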